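(* Let $k\ge 2$ and $n\ge 1$ be integers. The fixing number of the perfect $k$-ary tree $T_k^n$ of depth $n$ is $\operatorname{Fix}(T_k^n)=(k-1)\cdot k^{n-1}$.
   Context: All graphs are finite and simple. For $k\ge 2$, $n\ge 1$, the perfect $k$-ary tree of depth $n$, denoted $T_k^n$, is the connected acyclic graph with $k^n$ leaves in which one vertex (the root) has degree $k$ and is at distance $n$ from every leaf, and all other internal (non-leaf) vertices have degree $k+1$. A set $S\subseteq V(G)$ is a fixing set for a graph $G$ if the only automorphism of $G$ that fixes every element of $S$ is the trivial one; the fixing number $\operatorname{Fix}(G)$ is the smallest cardinality of a fixing set. *)

(* Defs.v *)
From mathcomp Require Import all_boot all_fingroup.

Set Implicit Arguments.
Unset Strict Implicit.
Unset Printing Implicit Defensive.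

(* A finite simple graph is a symmetric irreflexive relation e on a finite    *)
(* type T of vertices.                                                        *)
Section Graphs.
Variables (T : finType) (e : rel T).

Definition deg (x : T) : nat := #|[set y | e x y]|.

Definition leaves : {set T} := [set x | deg x == 1].

Definition connected : Prop := forall x y : T, connect e x y.

(* The size bound rules out the degenerate closed walks [::] and [:: x; y].   *)
Definition acyclic : Prop := forall c : seq T, 2 < size c -> ~ ucycle e c.

(* The least length of a walk from x to y; its value is #|T| when there is    *)
(* none, a walk of minimal length having fewer than #|T| edges.               *)
Definition gdist (x y : T) : nat :=
  find (fun d => [exists p : d.-tuple T, path e x p && (last x p == y)])
       (iota 0 #|T|).

Record perfect_tree (k n : nat) : Prop := PerfectTree {
  perfect_connected : connected;
  perfect_acyclic : acyclic;
  perfect_leaves : #|leaves| = k ^ n;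
  perfect_root : exists r : T,
    [/\ deg r = k,
        forall x, x \in leaves -> gdist r x = n
      & forall x, x != r -> x \notin leaves -> deg x = k.+1]
}.

Definition automorphism (f : {perm T}) : bool :=
  [forall x, forall y, e (f x) (f y) == e x y].

Definition fixing_set (S : {set T}) : bool :=
  [forall f : {perm T},
    automorphism f && [forall x in S, f x == x] ==> (f == 1%g)].

(* The default value [set: T] is always a fixing set, so this is a minimum.   *)
Definition fixing_number : nat :=
  #|[arg min_(S < [set: T] | fixing_set S) #|S|]|.

End Graphs.

(* Main.v *)
Require Import Defs.
From mathcomp Require Import all_boot all_fingroup.
From mathcomp Require Import zify.

(** Leaves with a common neighbour are twins, and swapping two twins is an
    automorphism, so a fixing set misses at most one leaf in each of the
    [k ^ (n - 1)] classes of [k] sibling leaves.  Conversely, take all leaves but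
    one per class: an automorphism fixing them fixes all parents of leaves, hence
    the omitted leaves too, and then every vertex, by induction from the leaves
    up: a vertex is the only neighbour of any of its children that is not
    further from the root. *)

Set Implicit Arguments.
Unset Strict Implicit.
Unset Printing Implicit Defensive.

Section Graph.
Variables (T : finType) (e : rel T).

(** * Distance and shortest walks *)

Lemma gdist_le x p : path e x p -> gdist e x (last x p) <= size p.
Proof.
move=> xp; rewrite /gdist leqNgt; apply/negP => lt_p.
have ltT : size p < #|T|.
  by apply: leq_trans lt_p _; rewrite -[leqRHS](size_iota 0) find_size.
have : [exists q : (size p).-tuple T, path e x q && (last x q == last x p)].
  by apply/existsP; exists (in_tuple p); rewrite xp /=.
by apply/negP/negbT; have := before_find 0 lt_p; rewrite nth_iota.
Qed.

Lemma gdist_path x y : connect e x y ->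
  exists p, [/\ path e x p, last x p = y & size p = gdist e x y].
Proof.
case/connectP=> q xq ->; case/shortenP: xq => p xp up _ {q}.
set z := last x p; rewrite /gdist; set a := fun d : nat => _.
(* A walk without repeated vertices has fewer than [#|T|] edges, so its length is in the range that
   [gdist] searches. *)
have ltT : size p < #|T|.
  by have := max_card (mem (x :: p)); rewrite (card_uniqP up).
have a_has : has a (iota 0 #|T|).
  apply/hasP; exists (size p); first by rewrite mem_iota.
  by apply/existsP; exists (in_tuple p); rewrite xp /=.
have lt_a : find a (iota 0 #|T|) < #|T|.
  by rewrite -{2}(size_iota 0 #|T|) -has_find.
have := nth_find 0 a_has; rewrite nth_iota // add0n.
case/existsP=> q /andP[xq /eqP last_q]; exists q.
by rewrite size_tuple.
Qed.

Lemma gdist_refl x : gdist e x x = 0.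
Proof. by apply/eqP; rewrite -leqn0; apply: (@gdist_le x [::]). Qed.

Lemma gdist_adj r x y : connect e r x -> e x y -> gdist e r y <= (gdist e r x).+1.
Proof.
case/gdist_path=> p [rp lp <-] xy.
have := @gdist_le r (rcons p y); rewrite last_rcons size_rcons rcons_path rp lp.
exact.
Qed.

Lemma gdist_pred r x : connect e r x -> x != r ->
  exists2 y, e y x & gdist e r y < gdist e r x.
Proof.
case/gdist_path=> p [rp lp <-]; case/lastP: p rp lp => [_ /= ->|p z].
  by rewrite eqxx.
rewrite rcons_path last_rcons => /andP[rp ez] <- _.
by exists (last r p); rewrite // size_rcons ltnS gdist_le.
Qed.

(** * Branches at a vertex of an acyclic graph *)

Definition avoiding x : rel T := [rel u v | [&& e u v, u != x & v != x]].

Lemma avoiding_sym x : symmetric e -> symmetric (avoiding x).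
Proof. by move=> e_sym u v; rewrite /avoiding /= e_sym [X in _ && X]andbC. Qed.

(** If [y] and [z] differed, a simple walk between them that misses [x] would close up through [x]
    into a cycle of length at least 3. *)
Lemma acyclic_neighbour_uniq x y z : symmetric e -> acyclic e ->
  y != x -> e x y -> e x z -> connect (avoiding x) y z -> y = z.
Proof.
move=> e_sym acyc yx xy xz /connectP[q yq zE]; rewrite {z}zE in xz *.
case/shortenP: yq xz => p yp up _ xz; case: p yp up xz => [//|z p] yp up xz.
case: (acyc [:: x, y, z & p]) => //.
have x_notin : forall s u, u != x -> path (avoiding x) u s -> x \notin s.
  elim=> [//|w s IHs] u ux /= /andP[/and3P[_ _ wx]] /(IHs _ wx).
  by rewrite inE negb_or eq_sym wx.
apply/andP; split.
  have sub : subrel (avoiding x) e by move=> u v /andP[].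
  change (path e x (rcons [:: y, z & p] x)); rewrite rcons_path.
  by rewrite (e_sym _ x) xz andbT /= xy; apply: (sub_path sub yp).
by rewrite cons_uniq up andbT inE negb_or eq_sym yx (x_notin _ y).
Qed.

(** * Automorphisms *)

Lemma automorphism_adj (f : {perm T}) :
  automorphism e f -> forall x y, e (f x) (f y) = e x y.
Proof. by move=> /forallP autf x y; apply/eqP; move/forallP: (autf x). Qed.

Lemma automorphism_leaf (f : {perm T}) x :
  automorphism e f -> (f x \in leaves e) = (x \in leaves e).
Proof.
move=> /automorphism_adj e_f; rewrite !inE; congr (_ == _).
rewrite /deg -(card_imset [set y | e x y] (@perm_inj _ f)); apply: eq_card => y.
rewrite inE; apply/idP/imsetP=> [fxy|[z]]; last by rewrite inE => xz ->; rewrite e_f.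
by exists (f^-1%g y); last rewrite permKV; rewrite // inE -e_f permKV.
Qed.

(** * Trees with a chosen root *)

Section Rooted.
Variable r : T.
Hypotheses (e_sym : symmetric e) (e_irr : irreflexive e).
Hypotheses (e_conn : connected e) (e_acyc : acyclic e).

Local Notation depth := (gdist e r).

(** Walk from [y] to the root with strictly decreasing depth: after the first step every vertex is
    shallower than [x], so [x] is never met. *)
Lemma connect_avoiding x y : y != x -> depth y <= depth x ->
  connect (avoiding x) y r.
Proof.
have [m] := ubnP (depth y); elim: m y => // m IHm y lt_m yx le_yx.
have [->|yr] := eqVneq y r; first exact: connect0.
have [z zy lt_zy] := gdist_pred (e_conn r y) yr.
have zx : z != x by apply: contraTneq lt_zy => ->; rewrite -leqNgt.
apply: connect_trans (connect1 _) (IHm z _ _ _) => //; try lia.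
by rewrite /avoiding /= e_sym zy yx.
Qed.

(** Both neighbours reach the root without passing through [x]. The non-strict bounds also exclude
    edges between vertices of equal depth. *)
Lemma shallow_neighbour_uniq x y z :
  e x y -> e x z -> depth y <= depth x -> depth z <= depth x -> y = z.
Proof.
have neq u : e x u -> u != x by apply: contraTneq => ->; rewrite e_irr.
move=> xy xz yx zx; apply: (@acyclic_neighbour_uniq x) => //; first exact: neq.
apply: connect_trans (connect_avoiding (neq _ xy) yx) _.
rewrite (sym_connect_sym (avoiding_sym x e_sym)).
exact: connect_avoiding (neq _ xz) zx.
Qed.

Lemma deeper_neighbour x : 1 < deg e x -> exists2 c, e x c & depth x < depth c.
Proof.
case/card_gt1P=> y [z []]; rewrite !inE => xy xz yz.
have [|yx] := ltnP (depth x) (depth y); first by exists y.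
have [|zx] := ltnP (depth x) (depth z); first by exists z.
by rewrite (shallow_neighbour_uniq xy xz) ?eqxx in yz.
Qed.

(** The summand [x != r] counts the one neighbour towards the root, which only the root lacks. *)
Lemma card_deeper_neighbours x :
  #|[set c | e x c & depth x < depth c]| + (x != r) = deg e x.
Proof.
have -> : deg e x = #|[set c | e x c & depth x < depth c]|
                    + #|[set c | e x c & depth c <= depth x]|.
  rewrite /deg -(cardsID [set c | depth x < depth c]); congr (_ + _).
    by apply: eq_card => c; rewrite !inE.
  by apply: eq_card => c; rewrite !inE -leqNgt andbC.
congr (_ + _); have [->|xr] := eqVneq x r.
  apply/esym/eqP; rewrite cards_eq0; apply/eqP/setP=> c; rewrite !inE gdist_refl.
  apply/negP=> /andP[rc c0]; have [/esym|cr] := eqVneq c r.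
    by apply/eqP; apply: contraTneq rc => <-; rewrite e_irr.
  by have [y _] := gdist_pred (e_conn r c) cr; lia.
have [y yx lt_yx] := gdist_pred (e_conn r x) xr; rewrite e_sym in yx.
apply/esym/eqP/cards1P; exists y; apply/setP=> c; rewrite !inE.
apply/andP/eqP=> [[xc cx]|->]; last by rewrite yx ltnW.
exact: shallow_neighbour_uniq xc yx cx (ltnW lt_yx).
Qed.

Lemma automorphism_fix_leaves (f : {perm T}) :
    (forall x, x \notin leaves e -> 1 < deg e x) ->
  automorphism e f -> {in leaves e, forall x, f x = x} -> f = 1%g.
Proof.
move=> deg_gt1 /automorphism_adj e_f fix_leaves.
have depth_le x : depth x <= #|T|.
  by rewrite -[leqRHS](size_iota 0) find_size.
apply/permP=> x; rewrite perm1.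
have [m] := ubnP (#|T| - depth x); elim: m x => // m IHm x lt_m.
have [/fix_leaves //|/deg_gt1 /deeper_neighbour [c xc lt_xc]] := boolP (x \in leaves e).
have fix_deeper y : depth x < depth y -> f y = y.
  by move=> lt_xy; apply: IHm; have := depth_le y; lia.
have cfx : e c (f x) by rewrite -{1}(fix_deeper c lt_xc) e_f e_sym.
have cx : e c x by rewrite e_sym.
(* Either [x] and [f x] are both neighbours of [c] that are no deeper than [c], or [f x] is deeper
   than [x] and so already fixed by [f]. *)
have [fx_c|c_fx] := leqP (depth (f x)) (depth c).
  exact: shallow_neighbour_uniq cfx cx fx_c (ltnW lt_xc).
by apply/(@perm_inj _ f)/fix_deeper/(ltn_trans lt_xc).
Qed.

(** * Leaves of a perfect tree and their parents *)

Section Perfect.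
Variables k n : nat.
Hypotheses (k_gt1 : 1 < k) (deg_root : deg e r = k).
Hypothesis depth_leaf : forall x, x \in leaves e -> depth x = n.
Hypothesis deg_internal :
  forall x, x != r -> x \notin leaves e -> deg e x = k.+1.

Lemma internal_deg_gt1 x : x \notin leaves e -> 1 < deg e x.
Proof.
have [->|xr /(deg_internal xr) ->] := eqVneq x r; first by rewrite deg_root.
exact: ltnW.
Qed.

(** A vertex of maximal depth has no deeper neighbour, hence is a leaf. *)
Lemma depth_le x : depth x <= n.
Proof.
have [y _ y_max] := @arg_maxnP T r xpredT (gdist e r) isT.
apply: leq_trans (y_max x isT) _.
have [/depth_leaf -> //|/internal_deg_gt1/deeper_neighbour[c _]] :=
  boolP (y \in leaves e).
by rewrite ltnNge => /negP[]; apply: y_max.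
Qed.

Lemma leafE x : (x \in leaves e) = (depth x == n).
Proof.
apply/idP/eqP=> [/depth_leaf //|xn]; apply: contraT.
by case/internal_deg_gt1/deeper_neighbour=> c _; rewrite xn ltnNge depth_le.
Qed.

Lemma card_children x : x \notin leaves e ->
  #|[set c | e x c & depth x < depth c]| = k.
Proof.
have := card_deeper_neighbours x.
have [-> /=|xr dx /(deg_internal xr)] := eqVneq x r; last by rewrite -dx addn1 => -[].
by rewrite addn0 deg_root.
Qed.

(** Meant for leaves, where [pick] has a single candidate; on an internal vertex it may return a
    child. *)
Definition parent x := odflt x [pick y | e x y].

Lemma leaf_adj x y : x \in leaves e -> e x y = (y == parent x).
Proof.
rewrite inE => /cards1P[z /setP xz].
have e_xE u : e x u = (u == z) by have := xz u; rewrite !inE.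
rewrite e_xE /parent; case: pickP => [u|/(_ z)]; last by rewrite e_xE eqxx.
by rewrite e_xE => /eqP ->.
Qed.

Definition parents := parent @: leaves e.

Lemma leaf_parent_depth x : x \in leaves e -> (depth (parent x)).+1 = n.
Proof.
move=> xL; have xr : x != r.
  by apply: contraTneq xL => ->; rewrite inE deg_root; case: k k_gt1 => [|[]].
(* The predecessor is shallower than [x] by at least one, and by adjacency by at most one. *)
have [y yx] := gdist_pred (e_conn r x) xr.
have := gdist_adj (e_conn r y) yx; move: yx; rewrite e_sym leaf_adj // => /eqP ->.
rewrite (depth_leaf xL); lia.
Qed.

Lemma card_leaf_siblings q : q \in parents ->
  #|[set x in leaves e | parent x == q]| = k.
Proof.
case/imsetP=> x xL qE; have := leaf_parent_depth xL; rewrite -qE => qn.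
have qL : q \notin leaves e by rewrite leafE; lia.
rewrite -(card_children qL); apply: eq_card => y; rewrite !inE -/(deg e y).
have := leafE y; rewrite inE => yE; rewrite yE.
apply/andP/andP=> [[yn /eqP yq]|[qy lt_qy]].
  split; last by rewrite (eqP yn); lia.
  by rewrite e_sym leaf_adj ?leafE ?yq.
(* A child of [q] is deeper than [n - 1], and no depth exceeds [n], so all [k] children of [q] are
   leaves. *)
have yn : depth y == n by have := depth_le y; lia.
by split=> //; rewrite eq_sym -leaf_adj ?leafE // e_sym.
Qed.

Lemma card_parents : #|leaves e| = #|parents| * k.
Proof.
rewrite -sum1_card (partition_big parent [in parents]) => [|x xL]; last exact: imset_f.
rewrite -sum_nat_const; apply: eq_bigr => q /card_leaf_siblings <-.
by rewrite -sum1_card; apply: eq_bigl => x; rewrite inE.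
Qed.

(** * Bounds on fixing sets *)

Lemma leaf_swap_automorphism x y : x \in leaves e -> y \in leaves e ->
  parent x = parent y -> automorphism e (tperm x y).
Proof.
move=> xL yL pxy.
have twin u : e x u = e y u by rewrite !leaf_adj // pxy.
(* Only one argument is transposed here; symmetry of [e] then handles the other. *)
have swap u v : e (tperm x y u) v = e u v.
  by case: tpermP => // ->; rewrite twin.
apply/forallP=> u; apply/forallP=> v.
by rewrite swap e_sym swap e_sym.
Qed.

Lemma fixing_set_lower S : fixing_set e S -> #|leaves e| <= #|S| + #|parents|.
Proof.
move=> /forallP fixS; rewrite -(cardsID S (leaves e)).
apply: leq_add; first exact/subset_leq_card/subsetIr.
(* Two siblings both outside [S] could be swapped by an automorphism fixing [S]. *)
have par_inj : {in leaves e :\: S &, injective parent}.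
  move=> x y /setDP[xL xS] /setDP[yL yS] pxy.
  have /implyP := fixS (tperm x y); rewrite leaf_swap_automorphism //=.
  have -> : [forall z in S, tperm x y z == z].
    by apply/forall_inP=> z zS; case: tpermP zS => // ->; rewrite (negPf xS, negPf yS).
  by move=> /(_ isT) /eqP /permP /(_ x); rewrite tpermL perm1.
rewrite -(card_in_imset par_inj) subset_leq_card //.
by apply/imsetS/subsetDl.
Qed.

Lemma fixing_set_upper :
  exists2 S, fixing_set e S & #|S| + #|parents| = #|leaves e|.
Proof.
(* [c q] is the leaf omitted from the class of [q]; the default is reached only outside
   [parents]. *)
pose c q := odflt q [pick x in leaves e | parent x == q].
have cP q : q \in parents -> c q \in leaves e /\ parent (c q) = q.
  case/imsetP=> x xL qE; rewrite /c; case: pickP => [y /andP[yL /eqP]|/(_ x)] //.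
  by rewrite xL qE eqxx.
have c_inj : {in parents &, injective c}.
  by move=> p q /cP[_ {2}<-] /cP[_ {2}<-] ->.
exists (leaves e :\: c @: parents); last first.
  rewrite -(card_in_imset c_inj) addnC.
  rewrite -(cardsID (c @: parents) (leaves e)) (setIidPr _) //.
  by apply/subsetP=> _ /imsetP[q /cP[cq _] ->].
apply/forallP=> f; apply/implyP=> /andP[autf /forall_inP fixS]; apply/eqP.
have e_f := automorphism_adj autf.
apply: (automorphism_fix_leaves _ autf); first exact: internal_deg_gt1.
have fixL x : x \in leaves e -> x != c (parent x) -> f x = x.
  move=> xL xc; apply/eqP/fixS; rewrite inE xL andbT.
  by apply: contra xc => /imsetP[q /cP[_ cq] ->]; rewrite cq.
have fix_parent q : q \in parents -> f q = q.
  (* Since [k] is at least 2, some child [x] of [q] is kept and fixed, so [f q] is a neighbour of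
     the leaf [x], that is, [q]. *)
  move=> qP; have : 0 < #|[set x in leaves e | parent x == q] :\ c q|.
    have := cardsD1 (c q) [set x in leaves e | parent x == q].
    rewrite card_leaf_siblings //; lia.
  case/card_gt0P=> x; rewrite 2!inE => /andP[xc]; rewrite inE => /andP[xL /eqP xq].
  apply/eqP; rewrite -xq -leaf_adj // -{1}(fixL x) ?xq // e_f leaf_adj //.
  by rewrite xq.
move=> x xL; have [xc|/(fixL x xL) //] := eqVneq x (c (parent x)).
have fxL : f x \in leaves e by rewrite automorphism_leaf.
have pfx : parent (f x) = parent x.
  apply/esym/eqP; rewrite -leaf_adj // -{1}(fix_parent (parent x)) ?imset_f //.
  by rewrite e_f leaf_adj.
(* [f x] is a sibling of [x]: either it is the omitted leaf, which is [x], or it is fixed by [f] and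
   injectivity applies. *)
have [fxc|fxc] := eqVneq (f x) (c (parent (f x))).
  by rewrite fxc pfx -xc.
by apply: (@perm_inj _ f); rewrite (fixL (f x)).
Qed.

End Perfect.
End Rooted.
End Graph.

Theorem proposition1 (k n : nat) (hk : 2 <= k) (hn : 1 <= n)
    (T : finType) (e : rel T)
    (e_sym : symmetric e) (e_irr : irreflexive e) :
  perfect_tree e k n -> fixing_number e = (k - 1) * k ^ (n - 1).
Proof.
case=> e_conn e_acyc card_L [r [deg_r depth_L deg_in]].
have kn : k ^ n = k ^ (n - 1) * k by rewrite -expnSr subn1 prednK.
have cardP : #|parents e| = k ^ (n - 1).
  have := card_parents e_sym e_irr e_conn e_acyc hk deg_r depth_L deg_in.
  rewrite card_L kn => /eqP.
  by rewrite eqn_pmul2r ?(ltnW hk) // => /eqP.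
have [S fixS cardS] :=
  fixing_set_upper e_sym e_irr e_conn e_acyc hk deg_r depth_L deg_in.
(* The minimum is characterised only once the default set is known to be fixing. *)
have fixT : fixing_set e [set: T].
  apply/forallP=> f; apply/implyP=> /andP[_ /forall_inP f_id].
  by apply/eqP/permP=> x; rewrite perm1; apply/eqP/f_id.
rewrite /fixing_number; case: arg_minnP => // A fixA minA.
(* The lower bound for [A] and its minimality against [S] squeeze [#|A|] to
   [k ^ n - k ^ (n - 1)]. *)
have := fixing_set_lower e_sym fixA; have := minA S fixS.
move: cardS; rewrite card_L cardP kn mulnBl mul1n [k * _]mulnC; lia.
Qed.
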